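(* Let $A$ be a sentence and let $\Gamma,\Delta$ be contexts of sentences. If in every classical Kripke model, at every possible world, the sentence $A$ is forced whenever all the sentences of $\Gamma$ are forced and all the sentences of $\Delta$ are refuted, then there exists a cut-free derivation in $\mathrm{LK}_{\mu\tilde\mu}$ of the sequent $\Gamma\vdash A\mid\Delta$.
   Context: Formulae are the standard, inductively defined formulae of predicate logic for the connectives $\top,\bot,\wedge,\vee,\to,\exists,\forall$, in a language with infinitely many constants. A sentence is a formula in which all variables are bound by quantifiers. An atomic formula is one built from a predicate symbol, without logical connectives. $\neg A$ abbreviates $A\to\bot$. All statements and proofs are constructive. **Classical Kripke models.** A classical Kripke model is a quintuple $(K,\le,D,\Vdash_s,\Vdash_\bot)$ with $K$ inhabited such that: - $(K,\le)$ is a poset (of ''possible worlds''); - $D$ is a function assigning a set $D(w)$ to each $w\in K$, with $D(w)\subseteq D(w')$ whenever $w\le w'$; the language is extended with a constant symbol for each element of $\bigcup_{w\in K}D(w)$; - $w:X(d_1,\dots,d_n)\Vdash_s$ (''$w$ strongly refutes $X(d_1,\dots,d_n)$'') is a binary relation between worlds and atomic sentences of the extended language such that $w:X(d_1,\dots,d_n)\Vdash_s$ implies $d_i\in D(w)$ for each $i$, and $w:X(d_1,\dots,d_n)\Vdash_s$ together with $w\le w'$ implies $w':X(d_1,\dots,d_n)\Vdash_s$; - $w:\Vdash_\bot$ (''$w$ is exploding'') is a unary relation on worlds such that $w:\Vdash_\bot$ and $w\le w'$ imply $w':\Vdash_\bot$. Strong refutation is extended to a relation between worlds $w$ and composite sentences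 of the extended language with constants in $D(w)$, inductively and simultaneously with forcing and refutation: - $w:\Vdash A$ ($A$ is forced in $w$) iff every $w'\ge w$ with $w':A\Vdash_s$ is exploding; - $w:A\Vdash$ ($A$ is refuted in $w$) iff every $w'\ge w$ with $w':\Vdash A$ is exploding; - $w:A\wedge B\Vdash_s$ iff $w:A\Vdash$ or $w:B\Vdash$; - $w:A\vee B\Vdash_s$ iff $w:A\Vdash$ and $w:B\Vdash$; - $w:A\to B\Vdash_s$ iff $w:\Vdash A$ and $w:B\Vdash$; - $w:\forall x.A(x)\Vdash_s$ iff $w:A(d)\Vdash$ for some $d\in D(w)$; - $w:\exists x.A(x)\Vdash_s$ iff for any $w'\ge w$ and $d\in D(w')$, $w':A(d)\Vdash$; - $\bot$ is always strongly refuted; $\top$ is never strongly refuted. **The calculus $\mathrm{LK}_{\mu\tilde\mu}$.** $\Gamma,\Delta$ are contexts of formulae (taken as ordered sequences when an unambiguous reading of the calculus as a typed $\lambda$-calculus is wanted). Sequents have the forms $\Gamma\vdash\Delta$, $\Gamma\mid A\vdash\Delta$, $\Gamma\vdash A\mid\Delta$. Rules (premises $\Rightarrow$ conclusion; rules without premises are stated by their conclusion alone): - $(\mathrm{Ax}_L)$: $\Gamma\mid A\vdash A,\Delta$; $(\mathrm{Ax}_R)$: $A,\Gamma\vdash A\mid\Delta$. (These two are the axiom rules.) - $(\tilde\mu)$: $\Gamma,A\vdash\Delta\Rightarrow\Gamma\mid A\vdash\Delta$; $(\mu)$: $\Gamma\vdash A,\Delta\Rightarrow\Gamma\vdash A\mid\Delta$.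 - $(\to_L)$: $\Gamma\vdash A\mid\Delta$ and $\Gamma\mid B\vdash\Delta\Rightarrow\Gamma\mid A\to B\vdash\Delta$; $(\to_R)$: $\Gamma,A\vdash B\mid\Delta\Rightarrow\Gamma\vdash A\to B\mid\Delta$. - $(\vee_L)$: $\Gamma\mid A\vdash\Delta$ and $\Gamma\mid B\vdash\Delta\Rightarrow\Gamma\mid A\vee B\vdash\Delta$; $(\vee_R^1)$: $\Gamma\vdash A\mid\Delta\Rightarrow\Gamma\vdash A\vee B\mid\Delta$; $(\vee_R^2)$: $\Gamma\vdash B\mid\Delta\Rightarrow\Gamma\vdash A\vee B\mid\Delta$. - $(\wedge_L^1)$: $\Gamma\mid A\vdash\Delta\Rightarrow\Gamma\mid A\wedge B\vdash\Delta$; $(\wedge_L^2)$: $\Gamma\mid B\vdash\Delta\Rightarrow\Gamma\mid A\wedge B\vdash\Delta$; $(\wedge_R)$: $\Gamma\vdash A\mid\Delta$ and $\Gamma\vdash B\mid\Delta\Rightarrow\Gamma\vdash A\wedge B\mid\Delta$. - $(\exists_L)$: $\Gamma\mid A(x)\vdash\Delta$, $x$ fresh $\Rightarrow\Gamma\mid\exists x.A(x)\vdash\Delta$; $(\exists_R)$: $\Gamma\vdash A(t)\mid\Delta\Rightarrow\Gamma\vdash\exists x.A(x)\mid\Delta$. - $(\forall_L)$: $\Gamma\mid A(t)\vdash\Delta\Rightarrow\Gamma\mid\forall x.A(x)\vdash\Delta$; $(\forall_R)$: $\Gamma\vdash A(x)\mid\Delta$, $x$ fresh $\Rightarrow\Gamma\vdash\forall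 x.A(x)\mid\Delta$. - $(\bot_L)$: $\Gamma\mid\bot\vdash\Delta$; $(\top_R)$: $\Gamma\vdash\top\mid\Delta$. - $(\mathrm{Cut})$: $\Gamma\vdash A\mid\Delta$ and $\Gamma\mid A\vdash\Delta\Rightarrow\Gamma\vdash\Delta$. Here $t$ is a term, and ''$x$ fresh'' means that the variable $x$ is not free in the conclusion. There are no explicit contraction rules; contractions are derived by a cut against an axiom. Accordingly, a derivation is called *cut-free* (or normal) if its only cuts are of the form of a cut between an axiom and an introduction rule; the rules $(\mu)$ and $(\tilde\mu)$ are not introduction rules, because they do not introduce a formula constructor.
   Formalization: ''Cut-free'' here also permits a cut between two axioms; with only cuts between an axiom and an introduction rule the claim fails, e.g. for Γ = X, Δ = X, A = ⊥ with X atomic. *)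

(* Defs.v *)
(* Stdlib only, without MathComp. *)
From Stdlib Require Import List Relations.
From Stdlib Require Vector.

Set Implicit Arguments.
Unset Strict Implicit.
Unset Printing Implicit Defensive.

(** * Syntax *)

(* Kripke models give no meaning to function symbols, so the non-logical
   symbols are predicate symbols and constants. *)
Record language : Type := Language {
  predicate : Type;
  arity : predicate -> nat;
  constant : Type;
  infinitely_many_constants :
    forall s : list constant, exists c, ~ List.In c s
}.

Section Syntax.
Variable L : language.

(* Variables are de Bruijn indices, for bound and free variables alike. *)
Inductive term : Type :=
| Var (x : nat)
| Const (c : constant L).

Inductive formula : Type :=
| Atom (X : predicate L) (ts : Vector.t term (arity X))
| Top
| Bot
| And (A B : formula)
| Or (A B : formula)
| Imp (A B : formula)
| Ex (A : formula)
| All (A : formula).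

Fixpoint free (x : nat) (A : formula) : Prop :=
  match A with
  | Atom ts => Vector.In (Var x) ts
  | Top | Bot => False
  | And A B | Or A B | Imp A B => free x A \/ free x B
  | Ex A | All A => free (S x) A
  end.

Definition sentence (A : formula) : Prop := forall x, ~ free x A.

Definition scons (T : Type) (a : T) (s : nat -> T) (x : nat) : T :=
  match x with 0 => a | S y => s y end.

Definition subst_term (s : nat -> term) (t : term) : term :=
  match t with Var x => s x | Const c => Const c end.

Definition shift (x : nat) : term := Var (S x).

Definition up (s : nat -> term) : nat -> term :=
  scons (Var 0) (fun x => subst_term shift (s x)).

Fixpoint subst (s : nat -> term) (A : formula) : formula :=
  match A with
  | Atom ts => Atom (Vector.map (subst_term s) ts)
  | Top => Top
  | Bot => Bot
  | And A B => And (subst s A) (subst s B)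
  | Or A B => Or (subst s A) (subst s B)
  | Imp A B => Imp (subst s A) (subst s B)
  | Ex A => Ex (subst (up s) A)
  | All A => All (subst (up s) A)
  end.

(* A(t), where A is the body of a quantifier. *)
Definition inst (A : formula) (t : term) : formula := subst (scons t Var) A.

(* Renames every free variable away from 0: variable 0 is fresh for [lift A]. *)
Definition lift (A : formula) : formula := subst shift A.

End Syntax.

Arguments Var {L} x.
Arguments Const {L} c.
Arguments Top {L}.
Arguments Bot {L}.

(** * Classical Kripke models *)

(* [element] is the ambient type of which the domains [dom w] are subsets.  For
   the sentences of the language to have a meaning at a world, each constant
   of the language must name an element of the domain of that world: this is
   [interp].  Only the domain conditions stated here are imposed; in
   particular [interp] need not be injective. *)
Record kripke_model (L : language) : Type := KripkeModel {
  world :> Type;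
  world_inhabited : inhabited world;
  le : relation world;
  le_order : order world le;
  element : Type;
  dom : world -> element -> Prop;
  dom_mono : forall w w' d, le w w' -> dom w d -> dom w' d;
  interp : constant L -> element;
  interp_dom : forall w c, dom w (interp c);
  srefutes_atom :
    world -> forall X : predicate L, Vector.t element (arity X) -> Prop;
  srefutes_atom_dom : forall w X (ds : Vector.t element (arity X)),
    srefutes_atom w ds -> Vector.Forall (dom w) ds;
  srefutes_atom_mono : forall w w' X (ds : Vector.t element (arity X)),
    le w w' -> srefutes_atom w ds -> srefutes_atom w' ds;
  exploding : world -> Prop;
  exploding_mono : forall w w', le w w' -> exploding w -> exploding w'
}.

Section Semantics.
Variables (L : language) (M : kripke_model L).

(* Forcing and refutation of a formula, given its strong refutation [P]. *)
Definition forces_of (P : M -> Prop) (w : M) : Prop :=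
  forall w', le w w' -> P w' -> exploding w'.

Definition refutes_of (P : M -> Prop) (w : M) : Prop :=
  forall w', le w w' -> forces_of P w' -> exploding w'.

Definition eval (rho : nat -> element M) (t : term L) : element M :=
  match t with Var x => rho x | Const c => interp M c end.

(* A formula [A] together with an assignment [rho] of elements to its free
   variables stands for the sentence of the extended language obtained by
   replacing each free variable by the constant for the assigned element;
   A(d) is thus the body of the quantifier under [scons d rho].  When [A] is a
   sentence, [rho] plays no role. *)
Fixpoint srefutes (rho : nat -> element M) (A : formula L) {struct A} :
    M -> Prop :=
  match A with
  | Atom ts => fun w => srefutes_atom w (Vector.map (eval rho) ts)
  | Top => fun _ => False
  | Bot => fun _ => True
  | And A B => fun w =>
      refutes_of (srefutes rho A) w \/ refutes_of (srefutes rho B) w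
  | Or A B => fun w =>
      refutes_of (srefutes rho A) w /\ refutes_of (srefutes rho B) w
  | Imp A B => fun w =>
      forces_of (srefutes rho A) w /\ refutes_of (srefutes rho B) w
  | Ex A => fun w => forall w' d, le w w' -> dom w' d ->
      refutes_of (srefutes (scons d rho) A) w'
  | All A => fun w => exists d, dom w d /\
      refutes_of (srefutes (scons d rho) A) w
  end.

Definition forces (rho : nat -> element M) (w : M) (A : formula L) : Prop :=
  forces_of (srefutes rho A) w.

Definition refutes (rho : nat -> element M) (w : M) (A : formula L) : Prop :=
  refutes_of (srefutes rho A) w.

End Semantics.

(** * The calculus LK-mu-mutilde *)

Section Calculus.
Variable L : language.

Definition context : Type := list (formula L).

Inductive sequent : Type :=
| Seq (Gamma Delta : context)                       (* Gamma |- Delta *)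
| SeqL (Gamma : context) (A : formula L) (Delta : context)
                                                    (* Gamma | A |- Delta *)
| SeqR (Gamma : context) (A : formula L) (Delta : context).
                                                    (* Gamma |- A | Delta *)

(* The order of formulae in a context is immaterial, hence membership in the
   axiom rules.  In [ExL] and [AllR] the fresh variable is 0: lifting the other
   formulae of the premise says that it is not free in the conclusion. *)
Inductive derivation : sequent -> Type :=
| AxL Gamma A Delta : List.In A Delta -> derivation (SeqL Gamma A Delta)
| AxR Gamma A Delta : List.In A Gamma -> derivation (SeqR Gamma A Delta)
| MuTilde Gamma A Delta :
    derivation (Seq (A :: Gamma) Delta) -> derivation (SeqL Gamma A Delta)
| Mu Gamma A Delta :
    derivation (Seq Gamma (A :: Delta)) -> derivation (SeqR Gamma A Delta)
| ImpL Gamma A B Delta :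
    derivation (SeqR Gamma A Delta) -> derivation (SeqL Gamma B Delta) ->
    derivation (SeqL Gamma (Imp A B) Delta)
| ImpR Gamma A B Delta :
    derivation (SeqR (A :: Gamma) B Delta) ->
    derivation (SeqR Gamma (Imp A B) Delta)
| OrL Gamma A B Delta :
    derivation (SeqL Gamma A Delta) -> derivation (SeqL Gamma B Delta) ->
    derivation (SeqL Gamma (Or A B) Delta)
| OrR1 Gamma A B Delta :
    derivation (SeqR Gamma A Delta) -> derivation (SeqR Gamma (Or A B) Delta)
| OrR2 Gamma A B Delta :
    derivation (SeqR Gamma B Delta) -> derivation (SeqR Gamma (Or A B) Delta)
| AndL1 Gamma A B Delta :
    derivation (SeqL Gamma A Delta) -> derivation (SeqL Gamma (And A B) Delta)
| AndL2 Gamma A B Delta :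
    derivation (SeqL Gamma B Delta) -> derivation (SeqL Gamma (And A B) Delta)
| AndR Gamma A B Delta :
    derivation (SeqR Gamma A Delta) -> derivation (SeqR Gamma B Delta) ->
    derivation (SeqR Gamma (And A B) Delta)
| ExL Gamma A Delta :
    derivation (SeqL (List.map (@lift L) Gamma) A (List.map (@lift L) Delta)) ->
    derivation (SeqL Gamma (Ex A) Delta)
| ExR Gamma A t Delta :
    derivation (SeqR Gamma (inst A t) Delta) ->
    derivation (SeqR Gamma (Ex A) Delta)
| AllL Gamma A t Delta :
    derivation (SeqL Gamma (inst A t) Delta) ->
    derivation (SeqL Gamma (All A) Delta)
| AllR Gamma A Delta :
    derivation (SeqR (List.map (@lift L) Gamma) A (List.map (@lift L) Delta)) ->
    derivation (SeqR Gamma (All A) Delta)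
| BotL Gamma Delta : derivation (SeqL Gamma Bot Delta)
| TopR Gamma Delta : derivation (SeqR Gamma Top Delta)
| Cut Gamma A Delta :
    derivation (SeqR Gamma A Delta) -> derivation (SeqL Gamma A Delta) ->
    derivation (Seq Gamma Delta).

Inductive rule_kind : Set := Axiom_rule | Introduction_rule | Mu_rule | Cut_rule.

Definition last_rule (S : sequent) (d : derivation S) : rule_kind :=
  match d with
  | AxL _ _ | AxR _ _ => Axiom_rule
  | MuTilde _ | Mu _ => Mu_rule
  | Cut _ _ => Cut_rule
  | _ => Introduction_rule
  end.

(* One premise of the cut is an axiom and the other is not a mu-rule.  Two
   axioms may be cut against each other: this is the only way in which
   X, Gamma |- X, Delta, with X atomic, can be derived by such cuts. *)
Definition normal_cut (k1 k2 : rule_kind) : Prop :=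
  match k1, k2 with
  | Axiom_rule, Introduction_rule
  | Introduction_rule, Axiom_rule
  | Axiom_rule, Axiom_rule => True
  | _, _ => False
  end.

Fixpoint cut_free (S : sequent) (d : derivation S) : Prop :=
  match d with
  | AxL _ _ | AxR _ _ | BotL _ _ | TopR _ _ => True
  | MuTilde d | Mu d | ImpR d | OrR1 _ d | OrR2 _ d | AndL1 _ d | AndL2 _ d
  | ExL d | ExR d | AllL d | AllR d => cut_free d
  | ImpL d e | OrL d e | AndR d e => cut_free d /\ cut_free e
  | Cut d e =>
      normal_cut (last_rule d) (last_rule e) /\ cut_free d /\ cut_free e
  end.

End Calculus.

(* Main.v *)
Require Import Defs.
From Stdlib Require Import List Relations Arith Lia.
From Stdlib Require Vector.

(** Completeness is proved constructively, by evaluating validity in a single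
    universal model rather than by building a countermodel.  Its worlds are the
    pairs (Gamma, Delta) of contexts, a later world having more formulae on each
    side; its individuals are the terms, at every world; an atom is strongly refuted at (Gamma, Delta) when it belongs to
    Delta; and (Gamma, Delta) is exploding when Gamma |- Delta has a cut-free
    derivation.  An assignment of individuals to variables is then a
    substitution.

    The core is the following pair of properties of a formula A under a
    substitution, proved together by induction on A for all worlds
    ([adequacy]):
    - if A is in Gamma then A is forced at (Gamma, Delta);
    - if A is in Delta then A is refuted at (Gamma, Delta).

    They are worth proving because they give at once the passage from
    semantics to derivations ([forced_derivable], [refuted_derivable]).  If
    (Gamma, Delta) forces A, then the later world (Gamma, A :: Delta) both
    forces and refutes A, so it explodes: Gamma |- A, Delta is derivable, and
    so is Gamma |- A | Delta by mu.  Dually, a refuted A yields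
    Gamma | A |- Delta by mu-tilde.  In the induction, these two facts for the
    immediate subformulae provide the premises of an introduction rule for A,
    and the conclusion of that rule is cut against the axiom given by the
    membership of A in Gamma or Delta.  Apart from the cut of two axioms that
    derives Gamma |- Delta from an atom common to both sides, these are the only
    cuts, so the derivations are cut-free.  The mu-rules only ever conclude a
    premise of an introduction rule or the whole derivation, never a premise of
    a cut.

    The theorem follows by looking at the world (Gamma, Delta) itself: it forces
    all of Gamma and refutes all of Delta, hence it forces A, hence
    Gamma |- A | Delta is derivable.

    Two syntactic facts about derivations are used.  Weakening makes explosion
    monotone.  Stability under substitution turns a derivation about a variable
    n fresh for the current world into the premise of an eigenvariable rule,
    where the fresh variable has to be 0.  Both are instances of
    [derivation_instance]. *)

(** * Substitution *)

Section Substitution.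
Context {L : language}.
Implicit Types (A B : formula L) (s t : nat -> term L).

Lemma subst_term_comp s t (u : term L) :
  subst_term t (subst_term s u) = subst_term (fun x => subst_term t (s x)) u.
Proof. now destruct u. Qed.

Lemma vector_map_ext_in (T U : Type) (f g : T -> U) n (v : Vector.t T n) :
  (forall a, Vector.In a v -> f a = g a) -> Vector.map f v = Vector.map g v.
Proof.
  induction v as [|a n v IH]; intros E; simpl; [reflexivity|].
  rewrite (E a) by constructor.
  f_equal; apply IH; intros b Hb; apply E; now constructor.
Qed.

Lemma subst_ext A : forall s t,
  (forall x, free x A -> s x = t x) -> subst s A = subst t A.
Proof.
  assert (up_ext : forall B s t, (forall x, free (S x) B -> s x = t x) ->
            forall x, free x B -> up s x = up t x).
  { intros B s t E [|x] Hx; simpl; [reflexivity|]. now rewrite (E x). }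
  induction A; simpl; intros s t E; f_equal; auto.
  - apply vector_map_ext_in; intros [x|c] Hx; simpl; auto.
  - apply IHA; eauto.
  - apply IHA; eauto.
Qed.

Lemma subst_comp A : forall s t r,
  (forall x, subst_term t (s x) = r x) -> subst t (subst s A) = subst r A.
Proof.
  assert (up_comp : forall s t r, (forall x, subst_term t (s x) = r x) ->
            forall x, subst_term (up t) (up s x) = up r x).
  { intros s t r E [|x]; simpl; [reflexivity|].
    rewrite <- E, !subst_term_comp; now destruct (s x). }
  induction A; simpl; intros s t r E; f_equal; eauto.
  rewrite Vector.map_map; apply Vector.map_ext; intros u.
  rewrite subst_term_comp; destruct u; simpl; auto.
Qed.

Lemma subst_id A : forall s, (forall x, s x = Var x) -> subst s A = A.
Proof.
  assert (up_id : forall s, (forall x, s x = Var x) ->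
            forall x, up s x = Var x).
  { intros s E [|x]; simpl; [reflexivity|]. now rewrite E. }
  induction A; simpl; intros s E; f_equal; auto.
  rewrite (@Vector.map_ext _ _ _ (fun u => u)); [apply Vector.map_id|].
  intros [x|c]; simpl; auto.
Qed.

Lemma subst_up_lift s A : subst (up s) (lift A) = lift (subst s A).
Proof.
  unfold lift. rewrite (@subst_comp A _ _ (fun x => subst_term (@shift L) (s x))).
  - symmetry; now apply subst_comp.
  - reflexivity.
Qed.

Lemma subst_inst s A u :
  subst s (inst A u) = inst (subst (up s) A) (subst_term s u).
Proof.
  unfold inst. rewrite (@subst_comp A _ _ (scons (subst_term s u) s)).
  - symmetry; apply subst_comp. intros [|x]; simpl; [reflexivity|].
    rewrite subst_term_comp; simpl; now destruct (s x).
  - now intros [|x].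
Qed.

Lemma inst_subst_up s A u : inst (subst (up s) A) u = subst (scons u s) A.
Proof.
  apply subst_comp. intros [|x]; simpl; [reflexivity|].
  rewrite subst_term_comp; simpl; now destruct (s x).
Qed.

Lemma free_bounded A : exists n, forall x, free x A -> x < n.
Proof.
  induction A as [X ts| | |A [n Hn] B [m Hm]|A [n Hn] B [m Hm]
                 |A [n Hn] B [m Hm]|A [n Hn]|A [n Hn]]; simpl.
  - generalize (arity X) ts; intros k v; induction v as [|u k v [n Hn]].
    + exists 0; intros x Hx; inversion Hx.
    + exists (n + match u with Var y => S y | Const _ => 0 end).
      intros x Hx; apply VectorSpec.In_cons_iff in Hx as [->|Hx]; [lia|].
      apply Hn in Hx; lia.
  - exists 0; tauto.
  - exists 0; tauto.
  - exists (n + m); intros x [H|H]; [apply Hn in H|apply Hm in H]; lia.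
  - exists (n + m); intros x [H|H]; [apply Hn in H|apply Hm in H]; lia.
  - exists (n + m); intros x [H|H]; [apply Hn in H|apply Hm in H]; lia.
  - exists n; intros x H; apply Hn in H; lia.
  - exists n; intros x H; apply Hn in H; lia.
Qed.

Lemma fresh_exists (l : context L) : exists n, forall A, In A l -> ~ free n A.
Proof.
  enough (exists n, forall A x, In A l -> free x A -> x < n) as [n Hn].
  { exists n; intros A HA H. apply (Nat.lt_irrefl n); eauto. }
  induction l as [|A l [n Hn]]; [exists 0; simpl; tauto|].
  destruct (free_bounded A) as [m Hm]; exists (n + m).
  intros B x [<-|HB] Hx; [apply Hm in Hx|apply (Hn B) in Hx]; auto; lia.
Qed.

(** Turns a variable [n] that is fresh for a sequent into the eigenvariable 0
    expected by the rules: on formulae without [n] it agrees with [lift]. *)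
Definition bring_to_front (n x : nat) : term L :=
  if Nat.eq_dec x n then Var 0 else Var (S x).

Lemma subst_bring_to_front n A : ~ free n A ->
  subst (bring_to_front n) A = lift A.
Proof.
  intros F; apply subst_ext; intros x Hx; unfold bring_to_front, shift.
  destruct (Nat.eq_dec x n); [congruence|reflexivity].
Qed.

Lemma subst_bring_to_front_inst n A : ~ free (S n) A ->
  subst (bring_to_front n) (inst A (Var n)) = A.
Proof.
  intros F; unfold inst.
  rewrite (@subst_comp A _ _ (scons (Var 0) (bring_to_front n))).
  2: { intros [|x]; simpl; [|reflexivity].
       unfold bring_to_front; now destruct (Nat.eq_dec n n). }
  rewrite <- (@subst_id A Var) at 2 by reflexivity.
  apply subst_ext; intros [|x] Hx; simpl; [reflexivity|].
  unfold bring_to_front; destruct (Nat.eq_dec x n); [congruence|reflexivity].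
Qed.

End Substitution.

(** * Instances of derivations *)

Section Derivations.
Context {L : language}.
Implicit Types (A B : formula L) (Gamma Delta : context L) (S : sequent L).

(** Weakening is built in because the calculus has no structural rule for it;
    together with the substitution it is pushed up to the axioms in one
    induction. *)
Definition sequent_instance (s : nat -> term L) S S' : Prop :=
  let included Gamma Gamma' := incl (map (subst s) Gamma) Gamma' in
  match S, S' with
  | Seq Gamma Delta, Seq Gamma' Delta' =>
      included Gamma Gamma' /\ included Delta Delta'
  | SeqL Gamma A Delta, SeqL Gamma' A' Delta'
  | SeqR Gamma A Delta, SeqR Gamma' A' Delta' =>
      included Gamma Gamma' /\ subst s A = A' /\ included Delta Delta'
  | _, _ => False
  end.

Lemma incl_map_lift s Gamma Gamma' : incl (map (subst s) Gamma) Gamma' ->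
  incl (map (subst (up s)) (map (@lift L) Gamma)) (map (@lift L) Gamma').
Proof.
  intros H; rewrite map_map; intros B HB.
  apply in_map_iff in HB as (A & <- & HA). rewrite subst_up_lift.
  apply in_map, H, in_map, HA.
Qed.

Lemma incl_map_cons s A Gamma Gamma' : incl (map (subst s) Gamma) Gamma' ->
  incl (map (subst s) (A :: Gamma)) (subst s A :: Gamma').
Proof. intros H B [<-|HB]; simpl; auto. Qed.

(** The last rule is preserved, as otherwise the restriction on cuts could not
    be. *)
Lemma derivation_instance S (d : derivation S) : cut_free d ->
  forall s S', sequent_instance s S S' ->
  exists d' : derivation S', cut_free d' /\ last_rule d' = last_rule d.
Proof.
  induction d; simpl; intros N s [Gamma' Delta'|Gamma' A' Delta'|Gamma' A' Delta'];
    try tauto; try (intros (HG & <- & HD); simpl).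
  - unshelve eexists (AxL _ _); [apply HD, in_map; assumption|easy].
  - unshelve eexists (AxR _ _); [apply HG, in_map; assumption|easy].
  - destruct (IHd N s (Seq (subst s A :: Gamma') Delta')) as (d' & N' & _).
    { split; [now apply incl_map_cons|assumption]. }
    now exists (MuTilde d').
  - destruct (IHd N s (Seq Gamma' (subst s A :: Delta'))) as (d' & N' & _).
    { split; [assumption|now apply incl_map_cons]. }
    now exists (Mu d').
  - destruct (IHd1 (proj1 N) s (SeqR Gamma' (subst s A) Delta')) as (d' & ? & _);
      [easy|].
    destruct (IHd2 (proj2 N) s (SeqL Gamma' (subst s B) Delta')) as (e' & ? & _);
      [easy|].
    now exists (ImpL d' e').
  - destruct (IHd N s (SeqR (subst s A :: Gamma') (subst s B) Delta'))
      as (d' & N' & _).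
    { split; [now apply incl_map_cons|easy]. }
    now exists (ImpR d').
  - destruct (IHd1 (proj1 N) s (SeqL Gamma' (subst s A) Delta')) as (d' & ? & _);
      [easy|].
    destruct (IHd2 (proj2 N) s (SeqL Gamma' (subst s B) Delta')) as (e' & ? & _);
      [easy|].
    now exists (OrL d' e').
  - destruct (IHd N s (SeqR Gamma' (subst s A) Delta')) as (d' & N' & _); [easy|].
    now exists (OrR1 (subst s B) d').
  - destruct (IHd N s (SeqR Gamma' (subst s B) Delta')) as (d' & N' & _); [easy|].
    now exists (OrR2 (subst s A) d').
  - destruct (IHd N s (SeqL Gamma' (subst s A) Delta')) as (d' & N' & _); [easy|].
    now exists (AndL1 (subst s B) d').
  - destruct (IHd N s (SeqL Gamma' (subst s B) Delta')) as (d' & N' & _); [easy|].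
    now exists (AndL2 (subst s A) d').
  - destruct (IHd1 (proj1 N) s (SeqR Gamma' (subst s A) Delta')) as (d' & ? & _);
      [easy|].
    destruct (IHd2 (proj2 N) s (SeqR Gamma' (subst s B) Delta')) as (e' & ? & _);
      [easy|].
    now exists (AndR d' e').
  - destruct (IHd N (up s) (SeqL (map (@lift L) Gamma') (subst (up s) A)
                              (map (@lift L) Delta'))) as (d' & N' & _).
    { now repeat split; try apply incl_map_lift. }
    now exists (ExL d').
  - destruct (IHd N s (SeqR Gamma' (inst (subst (up s) A) (subst_term s t)) Delta'))
      as (d' & N' & _).
    { now rewrite <- subst_inst. }
    now exists (ExR d').
  - destruct (IHd N s (SeqL Gamma' (inst (subst (up s) A) (subst_term s t)) Delta'))
      as (d' & N' & _).
    { now rewrite <- subst_inst. }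
    now exists (AllL d').
  - destruct (IHd N (up s) (SeqR (map (@lift L) Gamma') (subst (up s) A)
                              (map (@lift L) Delta'))) as (d' & N' & _).
    { now repeat split; try apply incl_map_lift. }
    now exists (AllR d').
  - now exists (BotL Gamma' Delta').
  - now exists (TopR Gamma' Delta').
  - destruct N as (K & N1 & N2); intros (HG & HD).
    destruct (IHd1 N1 s (SeqR Gamma' (subst s A) Delta')) as (d' & ? & E1);
      [easy|].
    destruct (IHd2 N2 s (SeqL Gamma' (subst s A) Delta')) as (e' & ? & E2);
      [easy|].
    exists (Cut d' e'); simpl. now rewrite E1, E2.
Qed.

Definition derivable S : Prop := exists d : derivation S, cut_free d.

Definition introducible S : Prop :=
  exists d : derivation S, cut_free d /\ last_rule d = Introduction_rule.

Lemma derivable_instance s S S' :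
  sequent_instance s S S' -> derivable S -> derivable S'.
Proof.
  intros H (d & N). destruct (derivation_instance S d N s S' H) as (d' & N' & _).
  now exists d'.
Qed.

Lemma derivable_weaken Gamma Delta Gamma' Delta' :
  incl Gamma Gamma' -> incl Delta Delta' ->
  derivable (Seq Gamma Delta) -> derivable (Seq Gamma' Delta').
Proof.
  intros HG HD; apply (derivable_instance Var); simpl.
  rewrite !(map_ext (subst Var) (fun A => A)), !map_id; auto;
    intros A; now apply subst_id.
Qed.

Lemma cut_against_hypothesis Gamma A Delta :
  In A Gamma -> introducible (SeqL Gamma A Delta) -> derivable (Seq Gamma Delta).
Proof.
  intros H (d & N & K). exists (Cut (AxR Delta H) d); simpl. now rewrite K.
Qed.

Lemma cut_against_conclusion Gamma A Delta :
  In A Delta -> introducible (SeqR Gamma A Delta) -> derivable (Seq Gamma Delta).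
Proof.
  intros H (d & N & K). exists (Cut d (AxL Gamma H)); simpl. now rewrite K.
Qed.

Lemma incl_map_bring_to_front n Gamma : (forall A, In A Gamma -> ~ free n A) ->
  incl (map (subst (bring_to_front n)) Gamma) (map (@lift L) Gamma).
Proof.
  intros F B HB; apply in_map_iff in HB as (A & <- & HA).
  rewrite subst_bring_to_front by auto. now apply in_map.
Qed.

(** The eigenvariable rules only need their premise for all instances by a
    term: one of these is a variable fresh for the conclusion, which can be
    renamed to 0. *)
Lemma introduce_ExL Gamma A Delta :
  (forall t, derivable (SeqL Gamma (inst A t) Delta)) ->
  introducible (SeqL Gamma (Ex A) Delta).
Proof.
  intros H; destruct (fresh_exists (Ex A :: Gamma ++ Delta)) as [n F].
  destruct (derivable_instance (bring_to_front n) (SeqL Gamma (inst A (Var n)) Delta)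
              (SeqL (map (@lift L) Gamma) A (map (@lift L) Delta))) as (d & N).
  - repeat split.
    + apply incl_map_bring_to_front; intros B HB; apply F; right.
      apply in_or_app; auto.
    + apply subst_bring_to_front_inst, (F (Ex A)); now left.
    + apply incl_map_bring_to_front; intros B HB; apply F; right.
      apply in_or_app; auto.
  - apply H.
  - now exists (ExL d).
Qed.

Lemma introduce_AllR Gamma A Delta :
  (forall t, derivable (SeqR Gamma (inst A t) Delta)) ->
  introducible (SeqR Gamma (All A) Delta).
Proof.
  intros H; destruct (fresh_exists (All A :: Gamma ++ Delta)) as [n F].
  destruct (derivable_instance (bring_to_front n) (SeqR Gamma (inst A (Var n)) Delta)
              (SeqR (map (@lift L) Gamma) A (map (@lift L) Delta))) as (d & N).
  - repeat split.
    + apply incl_map_bring_to_front; intros B HB; apply F; right.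
      apply in_or_app; auto.
    + apply subst_bring_to_front_inst, (F (All A)); now left.
    + apply incl_map_bring_to_front; intros B HB; apply F; right.
      apply in_or_app; auto.
  - apply H.
  - now exists (AllR d).
Qed.

End Derivations.

(** * Monotonicity in classical Kripke models *)

Section Kripke.
Context {L : language} {M : kripke_model L}.
Implicit Types (w : M) (A : formula L) (rho : nat -> element M).

Lemma le_refl w : le w w.
Proof. apply (le_order M). Qed.

Lemma le_trans w w' w'' : le w w' -> le w' w'' -> le w w''.
Proof. apply (le_order M). Qed.

Lemma forces_of_mono P w w' :
  le w w' -> forces_of P w -> forces_of P w'.
Proof. intros H F w'' H'; apply F; eauto using le_trans. Qed.

Lemma refutes_of_mono P w w' :
  le w w' -> refutes_of P w -> refutes_of P w'.
Proof. intros H F w'' H'; apply F; eauto using le_trans. Qed.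

Lemma srefutes_mono rho A w w' :
  le w w' -> srefutes rho A w -> srefutes rho A w'.
Proof.
  intros H; destruct A; simpl.
  - now apply srefutes_atom_mono.
  - tauto.
  - tauto.
  - intros [R|R]; eauto using refutes_of_mono.
  - intros [R1 R2]; eauto using refutes_of_mono.
  - intros [F R]; eauto using forces_of_mono, refutes_of_mono.
  - intros R w'' d H'; apply R; eauto using le_trans.
  - intros (d & Hd & R); exists d; eauto using dom_mono, refutes_of_mono.
Qed.

Lemma srefutes_refutes rho A w : srefutes rho A w -> refutes rho w A.
Proof.
  intros R w' H F. apply (F w' (le_refl w')); eauto using srefutes_mono.
Qed.

End Kripke.

(** * The universal model *)

Section Universal.
Context {L : language}.

(** Extension by concatenation on the left, rather than inclusion of contexts,
    is what makes the order antisymmetric. *)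
Definition extends (w w' : context L * context L) : Prop :=
  exists Gamma Delta, fst w' = Gamma ++ fst w /\ snd w' = Delta ++ snd w.

Lemma extends_order : order _ extends.
Proof.
  split.
  - intros w; now exists nil, nil.
  - intros w w' w'' (G & D & E1 & E2) (G' & D' & E1' & E2').
    exists (G' ++ G), (D' ++ D). now rewrite E1', E2', E1, E2, !app_assoc.
  - intros (G0, D0) (G1, D1) (G & D & E1 & E2) (G' & D' & E1' & E2'); simpl in *.
    assert (length G = 0) as NG.
    { pose proof (f_equal (@length _) E1); pose proof (f_equal (@length _) E1').
      rewrite !length_app in *; lia. }
    assert (length D = 0) as ND.
    { pose proof (f_equal (@length _) E2); pose proof (f_equal (@length _) E2').
      rewrite !length_app in *; lia. }
    apply length_zero_iff_nil in NG, ND; subst; reflexivity.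
Qed.

Lemma extends_incl w w' : extends w w' ->
  incl (fst w) (fst w') /\ incl (snd w) (snd w').
Proof.
  intros (G & D & -> & ->); split; now apply incl_appr, incl_refl.
Qed.

Lemma extends_consL A Gamma Delta : extends (Gamma, Delta) (A :: Gamma, Delta).
Proof. now exists (A :: nil), nil. Qed.

Lemma extends_consR A Gamma Delta : extends (Gamma, Delta) (Gamma, A :: Delta).
Proof. now exists nil, (A :: nil). Qed.

Definition universal_model : kripke_model L.
Proof.
  refine {|
    world := context L * context L;
    world_inhabited := inhabits (nil, nil);
    le := extends;
    le_order := extends_order;
    element := term L;
    dom := fun _ _ => True;
    interp := Const;
    srefutes_atom := fun w X ts => In (Atom ts) (snd w);
    exploding := fun w => derivable (Seq (fst w) (snd w))
  |}; try easy.
  - intros w X ts _; induction ts; now constructor.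
  - intros w w' X ts H; now apply extends_incl.
  - intros w w' H; now apply derivable_weaken; apply extends_incl.
Defined.

Notation U := universal_model.
Implicit Types (w : U) (A B : formula L) (rho : nat -> term L).

(** Forcing and refutation quantify over future worlds, but contexts only grow
    along the order; hence it is enough to ask for explosion at the world
    itself.  [hypothesis_forced] and [conclusion_refuted] restore the
    quantification. *)
Record adequate rho A : Prop := Adequate {
  forced : forall w, In (subst rho A) (fst w) ->
    srefutes (M := U) rho A w -> exploding w;
  refuted : forall w, In (subst rho A) (snd w) ->
    forces (M := U) rho w A -> exploding w
}.

Lemma hypothesis_forced rho A w : adequate rho A ->
  In (subst rho A) (fst w) -> forces (M := U) rho w A.
Proof. intros H HA w' Hw; apply (forced _ _ H), (extends_incl _ _ Hw), HA. Qed.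

Lemma conclusion_refuted rho A w : adequate rho A ->
  In (subst rho A) (snd w) -> refutes (M := U) rho w A.
Proof. intros H HA w' Hw; apply (refuted _ _ H), (extends_incl _ _ Hw), HA. Qed.

(** Once [A] is added to the conclusions, it is forced and refuted at the same
    time. *)
Lemma forced_derivable rho A w : adequate rho A ->
  forces (M := U) rho w A -> derivable (SeqR (fst w) (subst rho A) (snd w)).
Proof.
  destruct w as (Gamma, Delta); intros H F.
  pose proof (extends_consR (subst rho A) Gamma Delta) as Hw.
  destruct (refuted _ _ H (Gamma, subst rho A :: Delta)) as (d & N).
  - now left.
  - now apply (forces_of_mono (M := U) _ _ _ Hw).
  - now exists (Mu d).
Qed.

Lemma refuted_derivable rho A w : adequate rho A ->
  refutes (M := U) rho w A -> derivable (SeqL (fst w) (subst rho A) (snd w)).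
Proof.
  destruct w as (Gamma, Delta); intros H R.
  destruct (R (subst rho A :: Gamma, Delta)) as (d & N).
  - apply extends_consL.
  - apply hypothesis_forced; [assumption|now left].
  - now exists (MuTilde d).
Qed.

(** * Adequacy of the connectives and quantifiers *)

Lemma adequate_Atom rho X (ts : Vector.t (term L) (arity X)) :
  adequate rho (Atom ts).
Proof.
  assert (E : Vector.map (eval (M := U) rho) ts = Vector.map (subst_term rho) ts).
  { apply Vector.map_ext; now intros [x|c]. }
  split; intros w HA; simpl in *.
  - rewrite E; intros HA'. now exists (Cut (AxR _ HA) (AxL _ HA')).
  - intros F; apply (F w (le_refl (M := U) w)); simpl. now rewrite E.
Qed.

Lemma adequate_Top rho : adequate rho Top.
Proof.
  split; intros w HA; [easy|]. intros _.
  apply (cut_against_conclusion _ _ _ HA). now exists (TopR _ _).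
Qed.

Lemma adequate_Bot rho : adequate rho Bot.
Proof.
  split; intros w HA.
  - intros _. apply (cut_against_hypothesis _ _ _ HA). now exists (BotL _ _).
  - intros F; now apply (F w (le_refl (M := U) w)).
Qed.

(** A forced conjunction has forced conjuncts: where one of them is strongly
    refuted it is refuted, and so is the conjunction, strongly. *)
Lemma adequate_And rho A B :
  adequate rho A -> adequate rho B -> adequate rho (And A B).
Proof.
  intros HA HB; split; intros w Hin; simpl in Hin.
  - intros R; apply (cut_against_hypothesis _ _ _ Hin); destruct R as [R|R].
    + destruct (refuted_derivable _ _ _ HA R) as (d & N).
      now exists (AndL1 _ d).
    + destruct (refuted_derivable _ _ _ HB R) as (d & N).
      now exists (AndL2 _ d).
  - intros F; apply (cut_against_conclusion _ _ _ Hin).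
    destruct (forced_derivable rho A w HA) as (d & Nd).
    { intros w' Hw R; apply (F w' Hw); left. now apply srefutes_refutes. }
    destruct (forced_derivable rho B w HB) as (e & Ne).
    { intros w' Hw R; apply (F w' Hw); right. now apply srefutes_refutes. }
    now exists (AndR d e).
Qed.

(** Forcing [Or A B] says nothing about either disjunct.  It is enough that the
    disjunction be strongly refuted: a future world that forced a disjunct would
    derive it, and hence explode. *)
Lemma adequate_Or rho A B :
  adequate rho A -> adequate rho B -> adequate rho (Or A B).
Proof.
  intros HA HB; split; intros w Hin; simpl in Hin.
  - intros [RA RB]; apply (cut_against_hypothesis _ _ _ Hin).
    destruct (refuted_derivable _ _ _ HA RA) as (d & Nd).
    destruct (refuted_derivable _ _ _ HB RB) as (e & Ne).
    now exists (OrL d e).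
  - intros F; apply (F w (le_refl (M := U) w)); split; intros w' Hw F';
      apply (cut_against_conclusion _ _ _ (proj2 (extends_incl _ _ Hw) _ Hin)).
    + destruct (forced_derivable _ _ _ HA F') as (d & N).
      now exists (OrR1 _ d).
    + destruct (forced_derivable _ _ _ HB F') as (d & N).
      now exists (OrR2 _ d).
Qed.

(** A world forcing [Imp A B] forces [B] as soon as [A] is added to its
    hypotheses, because [A] is then forced. *)
Lemma adequate_Imp rho A B :
  adequate rho A -> adequate rho B -> adequate rho (Imp A B).
Proof.
  intros HA HB; split; intros w Hin; simpl in Hin.
  - intros [FA RB]; apply (cut_against_hypothesis _ _ _ Hin).
    destruct (forced_derivable _ _ _ HA FA) as (d & Nd).
    destruct (refuted_derivable _ _ _ HB RB) as (e & Ne).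
    now exists (ImpL d e).
  - intros F; apply (cut_against_conclusion _ _ _ Hin).
    destruct w as (Gamma, Delta).
    set (w' := (subst rho A :: Gamma, Delta) : U).
    assert (Hw' : le (k := U) (Gamma, Delta) w') by apply extends_consL.
    destruct (forced_derivable rho B w' HB) as (d & N).
    { intros w'' Hw'' R; apply (F w'' (le_trans (M := U) _ _ _ Hw' Hw'')); split.
      - apply (forces_of_mono (M := U) _ _ _ Hw'').
        apply hypothesis_forced; [assumption|now left].
      - now apply srefutes_refutes. }
    now exists (ImpR d).
Qed.

Lemma adequate_Ex rho A :
  (forall t, adequate (scons t rho) A) -> adequate rho (Ex A).
Proof.
  intros HA; split; intros w Hin; simpl in Hin.
  - intros R; apply (cut_against_hypothesis _ _ _ Hin), introduce_ExL; intros t.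
    rewrite inst_subst_up. apply refuted_derivable; [apply HA|].
    now apply (R w t (le_refl (M := U) w)).
  - intros F; apply (F w (le_refl (M := U) w)); intros w' t Hw _ w'' Hw'' F'.
    pose proof (le_trans (M := U) _ _ _ Hw Hw'') as H.
    apply (cut_against_conclusion _ _ _ (proj2 (extends_incl _ _ H) _ Hin)).
    pose proof (forced_derivable _ _ _ (HA t) F') as D.
    rewrite <- inst_subst_up in D. destruct D as (d & N). now exists (ExR d).
Qed.

Lemma adequate_All rho A :
  (forall t, adequate (scons t rho) A) -> adequate rho (All A).
Proof.
  intros HA; split; intros w Hin; simpl in Hin.
  - intros (t & _ & R); apply (cut_against_hypothesis _ _ _ Hin).
    pose proof (refuted_derivable _ _ _ (HA t) R) as D.
    rewrite <- inst_subst_up in D. destruct D as (d & N). now exists (AllL d).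
  - intros F; apply (cut_against_conclusion _ _ _ Hin), introduce_AllR; intros t.
    rewrite inst_subst_up. apply forced_derivable; [apply HA|].
    intros w' Hw R; apply (F w' Hw); exists t; split; [exact I|].
    now apply srefutes_refutes.
Qed.

Theorem adequacy A : forall rho, adequate rho A.
Proof.
  induction A; intros rho;
    auto using adequate_Atom, adequate_Top, adequate_Bot, adequate_And,
      adequate_Or, adequate_Imp, adequate_Ex, adequate_All.
Qed.

End Universal.

(** * Completeness *)

Theorem corollary19 (L : language) (A : formula L) (Gamma Delta : context L)
    (A_sentence : sentence A)
    (Gamma_sentences : Forall (@sentence L) Gamma)
    (Delta_sentences : Forall (@sentence L) Delta)
    (A_valid :
      forall (M : kripke_model L) (w : M) (rho : nat -> element M),
        Forall (forces rho w) Gamma ->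
        Forall (refutes rho w) Delta ->
        forces rho w A) :
  exists d : derivation (SeqR Gamma A Delta), cut_free d.
Proof.
  assert (subst_Var : forall B : formula L, subst Var B = B).
  { intros B; now apply subst_id. }
  pose proof (forced_derivable Var A (Gamma, Delta) (adequacy A Var)) as H.
  rewrite subst_Var in H. apply H, A_valid; apply Forall_forall; intros B HB.
  - apply hypothesis_forced; [apply adequacy|now rewrite subst_Var].
  - apply conclusion_refuted; [apply adequacy|now rewrite subst_Var].
Qed.
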